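(* Consider the misspecified Nash–Cournot game and Algorithm II described in the context, and suppose (A5), (A6), (A7) and (A8) of the context hold. Let $\{x_i^k,\hat\theta_i^k\}$, $i=1,\dots,N$, be computed by Algorithm II. Then for every $i=1,\dots,N$, $\hat\theta_i^k\to\theta^*$ almost surely and $x_i^k\to x^*$ almost surely as $k\to\infty$, where $x^*=(x_1^*,\dots,x_N^* )$ is the solution of the variational inequality: $x^*\in K=\prod_jK_j$ and $(y-x^* )^TF(x^* )\ge0$ for all $y\in K$, with $F_j(x)=c_j'(x_j)-a^*+b^*\sum_{l=1}^Nx_l+b^*x_j$.
   Context: Game: $N$ firms; firm $j$ chooses output $x_j\in K_j\subseteq[0,\infty)$ and minimizes $f_j(x;\theta)=c_j(x_j)-p(X)x_j$, where $X=\sum_{l}x_l$ and the true price is $p(X)=a^*-b^*X$ with $a^*,b^*>0$. For a vector $z=(z_1,\dots,z_N)$ of outputs, $Z=\sum_lz_l$ and a parameter value $\theta$, write $\nabla_{z_j}f_j(z;\theta)$ for the derivative of $c_j(z_j)-\hat p(Z;\theta)z_j$ in $z_j$, where $\hat p(Z;\theta)=\theta-b^*Z$ in case (A5a) and $\hat p(Z;\theta)=a^*-\theta Z$ in case (A5b). (A5) Exactly one of: (A5a) firms know $b^*$ but not $a^*$; the unknown parameter is $\theta^*=a^*$, and the price observed at output $X$ is $(a^*+\xi)-b^*X$; or (A5b) firms know $a^*$ but not $b^*$; $\theta^*=b^*$, and the observed price is $a^*-(b^*+\xi)X$. Here $\xi^1,\xi^2,\dots$ are i.i.d. real random variables with mean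 zero. (A6) (Common knowledge) All cost functions $c_j$ and sets $K_j$ are common knowledge; aggregate output is unobservable. (A7) Each $c_j$ is convex and continuously differentiable with $c_j'$ Lipschitz on $K_j$; $\Theta$ is closed, convex, bounded; each $K_j$ is nonempty, closed, convex, bounded. (A8) $\Theta=[\delta,\Delta]$ with $0<\delta<\theta^*+\xi^k<\Delta$ for all $k$; the $K_j$ are bounded. Also, at least one $K_j$ requires strictly positive output, so that estimated aggregates below are strictly positive. Algorithm II: given a positive sequence $\epsilon^k\downarrow0$ and constants $\gamma_x,\gamma_\theta>0$. Firm $j$'s actual initial output is $x_{jj}^0$, $X^0=\sum_jx_{jj}^0$, $p^0=a^*-b^*X^0$, and $\bar\vartheta_i^0=0$ for all $i$. At step $k\ge0$, each firm $i$ computes $x_i^{k+1}=(x_{i1}^{k+1},\dots,x_{iN}^{k+1})$ (its estimate of all firms' outputs) and $\theta_i^{k+1}$ as a solution of $x_{ij}^{k+1}=\Pi_{K_j}\big(x_{ij}^{k+1}-\gamma_x(\nabla_{x_{ij}}f_j(x_i^{k+1};\hat\theta_i^{k+1})+\epsilon^kx_{ij}^{k+1})\big)$, $j=1,\dots,N$, $\theta_i^{k+1}=\Pi_\Theta\big(\theta_i^{k+1}-\gamma_\theta(\tilde p_i^k+\epsilon^k\theta_i^{k+1})\big)$, where $\hat\theta_i^{k+1}=\frac{1}{k+1}\theta_i^{k+1}+\frac{k}{k+1}\bar\vartheta_i^k$, $X_i^{k+1}=\sum_jx_{ij}^{k+1}$, and $\tilde p_i^k=\hat p(X_i^{k+1};\hat\theta_i^{k+1})-p^k$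 in case (A5a), $\tilde p_i^k=p^k-\hat p(X_i^{k+1};\hat\theta_i^{k+1})$ in case (A5b). Firm $j$ actually produces $x_{jj}^{k+1}$; for $k\ge1$, $X^k=\sum_jx_{jj}^k$ and $p^k$ is the observed (noisy) price at $X^k$ with noise $\xi^k$. Each firm forms $\vartheta_i^k=p^k+b^*X_i^k$ in case (A5a) and $\vartheta_i^k=(a^*-p^k)/X_i^k$ in case (A5b), and updates $\bar\vartheta_i^k=((k-1)\bar\vartheta_i^{k-1}+\vartheta_i^k)/k$. $\Pi_C$ is Euclidean projection onto $C$. *)

(* Defs.v *)
From HB Require Import structures.
From mathcomp Require Import all_boot all_order all_algebra.
From mathcomp Require Import all_classical all_reals all_analysis.
Set Implicit Arguments. Unset Strict Implicit. Unset Printing Implicit Defensive.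
Import Order.TTheory GRing.Theory Num.Theory.
Import numFieldNormedType.Exports.
Local Open Scope classical_set_scope.
Local Open Scope ring_scope.

Section Defs.
Context {R : realType}.

Definition convex_setR (C : set R) : Prop :=
  forall x y t, C x -> C y -> 0 <= t <= 1 -> C (t * x + (1 - t) * y).

Definition convex_on (C : set R) (f : R -> R) : Prop :=
  forall x y t, C x -> C y -> 0 <= t <= 1 ->
    f (t * x + (1 - t) * y) <= t * f x + (1 - t) * f y.

Definition is_proj (C : set R) (y p : R) : Prop :=
  C p /\ forall q, C q -> `|y - p| <= `|y - q|.

Definition Theta_set (delta Delta : R) : set R := [set t | delta <= t <= Delta].

(** Case flag: caseA = true  <-> (A5a) [a* unknown, theta* = a* ],
               caseA = false <-> (A5b) [b* unknown, theta* = b* ]. *)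
Definition theta_star (caseA : bool) (a b : R) : R := if caseA then a else b.

Definition phat (caseA : bool) (a b : R) (Z th : R) : R :=
  if caseA then th - b * Z else a - th * Z.

Definition obs_price (caseA : bool) (a b : R) (xi X : R) : R :=
  if caseA then (a + xi) - b * X else a - (b + xi) * X.

(** nabla_{z_j} f_j(z; theta) = derivative in z_j of c_j(z_j) - phat(Z;theta) z_j,
    written out: c_j'(z_j) - phat(Z;theta) + (d/dZ of -phat) * z_j. *)
Definition grad_f (caseA : bool) (a b : R) (N : nat) (c : 'I_N -> R -> R)
    (j : 'I_N) (z : 'I_N -> R) (th : R) : R :=
  derive1 (c j) (z j) - phat caseA a b (\sum_(l < N) z l) th
  + (if caseA then b else th) * z j.

Definition F_VI (a b : R) (N : nat) (c : 'I_N -> R -> R) (x : 'I_N -> R) (j : 'I_N) : R :=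
  derive1 (c j) (x j) - a + b * (\sum_(l < N) x l) + b * x j.

Definition solves_VI (a b : R) (N : nat) (c : 'I_N -> R -> R) (K : 'I_N -> set R)
    (xs : 'I_N -> R) : Prop :=
  (forall j, K j (xs j)) /\
  forall y : 'I_N -> R, (forall j, K j (y j)) ->
    0 <= \sum_(j < N) (y j - xs j) * F_VI a b c xs j.

(** ----- Quantities produced along one run of Algorithm II (sample point w).
   x i k w j = x_{ij}^k (firm i's estimate at step k of firm j's output),
   th i k w   = theta_i^k,   xi k w = xi^k (noise, used for k >= 1). *)
Section Run.
Variables (T : Type) (caseA : bool) (a b : R) (N : nat).
Variables (x : 'I_N -> nat -> T -> 'I_N -> R) (th : 'I_N -> nat -> T -> R)
          (xi : nat -> T -> R).

Definition Xest (i : 'I_N) (k : nat) (w : T) : R := \sum_(j < N) x i k w j.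
Definition Xact (k : nat) (w : T) : R := \sum_(j < N) x j k w j.
Definition price (k : nat) (w : T) : R :=
  if k is 0 then a - b * Xact 0 w else obs_price caseA a b (xi k w) (Xact k w).
Definition vtheta (i : 'I_N) (k : nat) (w : T) : R :=
  if caseA then price k w + b * Xest i k w else (a - price k w) / Xest i k w.
Fixpoint bvtheta (i : 'I_N) (k : nat) (w : T) : R :=
  if k is k'.+1 then (k'%:R * bvtheta i k' w + vtheta i k'.+1 w) / k'.+1%:R else 0.
(** hat theta_i^{k+1} = theta_i^{k+1}/(k+1) + k/(k+1) bar vartheta_i^k
    (hat theta_i^0 is not used by the algorithm; set to theta_i^0). *)
Definition thhat (i : 'I_N) (k : nat) (w : T) : R :=
  if k is k'.+1 then th i k'.+1 w / k'.+1%:R + k'%:R / k'.+1%:R * bvtheta i k' w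
  else th i 0 w.
Definition ptilde (i : 'I_N) (k : nat) (w : T) : R :=
  if caseA then phat caseA a b (Xest i k.+1 w) (thhat i k.+1 w) - price k w
  else price k w - phat caseA a b (Xest i k.+1 w) (thhat i k.+1 w).
End Run.

End Defs.

Definition mutually_independent {d} {T : measurableType d} {R : realType}
    (P : probability T R) (X : nat -> T -> R) : Prop :=
  forall (s : seq nat), uniq s -> forall B : nat -> set R,
    (forall k, measurable (B k)) ->
    P (\bigcap_(k in [set` s]) (X k @^-1` B k)) = (\prod_(k <- s) P (X k @^-1` B k))%E.

(* Main.v *)
Require Import Defs.
From HB Require Import structures.
From mathcomp Require Import all_boot all_order all_algebra.
From mathcomp Require Import all_classical all_reals all_analysis.
From mathcomp Require Import measurable_realfun ring lra.
Import Order.TTheory GRing.Theory Num.Theory.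
Import numFieldNormedType.Exports.
Local Open Scope classical_set_scope.
Local Open Scope ring_scope.

(** The coupled fixed-point system solved by a firm at each step has at most one
    solution: raising the parameter estimate cannot lower the mismatch between
    predicted and observed price, while the regularisation makes the parameter
    equation strictly monotone; for a given estimate the outputs solve a strongly
    monotone variational inequality. Hence, by induction on the step, all firms
    hold identical estimates, each one's estimated aggregate is the actual one,
    and the reconstructed parameter is exactly [theta* + xi^k]. Its running mean
    tends to [theta*] almost surely by the strong law of large numbers, obtained
    for bounded orthogonal variables from second moments along the squares.
    Finally, strong monotonicity with modulus [b*] bounds the squared distance of
    the outputs to [x*] by a multiple of the parameter error plus [eps^k]. *)

(** * Convexity and projections *)

(** Moving from [x] to [x + t * (y - x)] changes the squared distance to the projected point by [t *
    (2 * g * ((y - x) * G) + t * (y - x) ^+ 2)]; minimality at [x] excludes a negative linear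
    coefficient. *)
Lemma is_proj_variational {R : realType} (C : set R) (x g G y : R) :
  convex_setR C -> 0 < g -> is_proj C (x - g * G) x -> C y ->
  0 <= (y - x) * G.
Proof.
move=> Ccvx g0 [Cx xmin] Cy; rewrite leNgt; apply/negP => neg.
have yx0 : 0 < (y - x) ^+ 2.
  rewrite exprn_even_gt0//=; apply/eqP => yx.
  by move: neg; rewrite yx mul0r ltxx.
have small t : 0 <= t <= 1 -> 0 <= t * (2 * g * ((y - x) * G) + t * (y - x) ^+ 2).
  move=> t01; have := xmin _ (Ccvx y x t Cy Cx t01).
  rewrite -(@ler_pXn2r _ 2)// ?nnegrE// -!normrX !ger0_norm ?sqr_ge0// => H.
  nra.
(* [s] minimises this quadratic in [t]; capping it at 1 keeps the point in [C]. *)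
pose s := - (g * ((y - x) * G)) / (y - x) ^+ 2.
have s0 : 0 < s by rewrite divr_gt0// oppr_gt0 pmulr_rlt0.
have sE : s * (y - x) ^+ 2 = - (g * ((y - x) * G)) by rewrite mulfVK// gt_eqF.
have gneg : g * ((y - x) * G) < 0 by rewrite pmulr_rlt0.
pose t := Num.min 1 s.
have t0 : 0 < t by rewrite lt_min ltr01.
have ts : t <= s by rewrite ge_min lexx orbT.
have := small t; rewrite (ltW t0) ge_min lexx => /(_ isT).
rewrite pmulr_rge0// => H.
have : t * (y - x) ^+ 2 <= s * (y - x) ^+ 2 by rewrite ler_pM2r.
rewrite sE; lra.
Qed.

Lemma convex_on_derive1_le {R : realType} (C : set R) (f : R -> R) (x y : R) :
  convex_on C f -> C x -> C y -> derivable f x 1 ->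
  derive1 f x * (y - x) <= f y - f x.
Proof.
move=> fcvx Cx Cy fx.
have [->|yx] := eqVneq y x; first by rewrite !subrr mulr0.
have h0 : y - x != 0 by rewrite subr_eq0.
(* Convexity controls [f] only on the segment, so the derivative is read off along points of it,
   tending to [x] from the side of [y]. *)
pose u n : R := (y - x) * harmonic n.
have u0 : u @ \oo --> 0.
  by rewrite -[0](mulr0 (y - x)); apply: cvgMl_tmp; exact: cvg_harmonic.
have un0 n : u n != 0 by rewrite mulf_neq0// gt_eqF// harmonic_gt0.
have fd : (fun t => t^-1 * (f (t + x) - f x)) t @[t --> 0^'] --> derive1 f x.
  rewrite derive1E; apply: cvg_trans fx.
  apply: near_eq_cvg; near=> t; rewrite /= /GRing.scale/= mulr1//.
have uc : u n @[n --> \oo] --> 0^'.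
  move=> A /=; rewrite /nbhs/= /within/= => A0.
  have := u0 _ A0; rewrite /nbhs/=; apply: filterS => n /=; apply; exact: un0.
have lc := cvg_comp _ _ uc fd.
have lc' : ((u n)^-1 * (f (u n + x) - f x)) * (y - x) @[n --> \oo]
    --> derive1 f x * (y - x) by apply: cvgMr_tmp.
rewrite -(cvg_lim _ lc')//; apply: limr_le; first by apply/cvg_ex; eexists; exact: lc'.
near=> n.
have t01 : 0 <= @harmonic R n <= 1.
  rewrite harmonic_ge0/= invf_le1// ?ltr0n// ler1n//.
have H0 : @harmonic R n != 0 by rewrite gt_eqF// harmonic_gt0.
have := fcvx y x (harmonic n) Cy Cx t01.
have -> : harmonic n * y + (1 - harmonic n) * x = u n + x by rewrite /u; ring.
move=> H.
have -> : (u n)^-1 * (f (u n + x) - f x) * (y - x) = (f (u n + x) - f x) / harmonic n.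
  by rewrite /u; field; rewrite h0 H0.
rewrite ler_pdivrMr ?harmonic_gt0//; lra.
Unshelve. all: by end_near.
Qed.

Lemma convex_on_derive1_mono {R : realType} (C : set R) (f : R -> R) (x y : R) :
  convex_on C f -> C x -> C y -> derivable f x 1 -> derivable f y 1 ->
  0 <= (x - y) * (derive1 f x - derive1 f y).
Proof.
move=> fc Cx Cy fx fy.
have := convex_on_derive1_le C f x y fc Cx Cy fx.
have := convex_on_derive1_le C f y x fc Cy Cx fy.
nra.
Qed.

(** * Uniqueness and stability of regularised equilibria *)

(** What the convexity of the costs contributes to the equilibrium arguments. *)
Definition monotone_marginal {R : realType} {N : nat} (c : 'I_N -> R -> R)
    (K : 'I_N -> set R) : Prop :=
  forall j u v, K j u -> K j v ->
    0 <= (u - v) * (derive1 (c j) u - derive1 (c j) v).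

(** Variational form of the output equations, free of the step length; componentwise because the
    feasible set is a product, with [e] the Tikhonov weight. *)
Definition regularized_equilibrium {R : realType} {N : nat} (caseA : bool)
    (a b : R) (c : 'I_N -> R -> R) (K : 'I_N -> set R) (t e : R)
    (z : 'I_N -> R) : Prop :=
  forall j, K j (z j) /\ forall y, K j y ->
    0 <= (y - z j) * (grad_f caseA a b c j z t + e * z j).

Section Game.
Context {R : realType} {N : nat}.
Implicit Types (caseA : bool) (a b t e : R) (z : 'I_N -> R)
  (c : 'I_N -> R -> R) (K : 'I_N -> set R).

(** When each equilibrium is tested against the other and the results are summed, the price slope
    contributes [s * D ^+ 2] and the regularisation a positive definite term. *)
Lemma regularized_equilibrium_unique caseA a b c K t e z z' :
  monotone_marginal c K -> 0 < e -> 0 <= (if caseA then b else t) ->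
  regularized_equilibrium caseA a b c K t e z ->
  regularized_equilibrium caseA a b c K t e z' ->
  z = z'.
Proof.
move=> mono e0; set s := (if caseA then b else t) => s0 zE z'E.
pose D := \sum_(l < N) z l - \sum_(l < N) z' l.
have key j : s * D * (z j - z' j) + e * (z j - z' j) ^+ 2 <= 0.
  have [Kz /(_ (z' j)) H] := zE j; have [Kz' /(_ (z j)) H'] := z'E j.
  have {}H := H Kz'; have {}H' := H' Kz; have M := mono j _ _ Kz Kz'.
  have sq : 0 <= s * (z j - z' j) ^+ 2 by rewrite mulr_ge0// sqr_ge0.
  have phD : phat caseA a b (\sum_(l < N) z l) t -
             phat caseA a b (\sum_(l < N) z' l) t = - (s * D).
    by rewrite /phat /s /D; case: (caseA); ring.
  move: H H'; rewrite /grad_f -/s; set G := phat _ _ _ _ _ in phD *.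
  set G' := phat _ _ _ _ _ in phD *; rewrite (_ : G = G' - s * D); last lra.
  move=> H H'; nra.
have sumle : s * D ^+ 2 + e * \sum_(j < N) (z j - z' j) ^+ 2 <= 0.
  rewrite expr2 mulrA {2}/D -sumrB !mulr_sumr -big_split/=.
  by apply: sumr_le0 => j _; exact: key.
have sD : 0 <= s * D ^+ 2 by rewrite mulr_ge0// sqr_ge0.
have sum0 : \sum_(j < N) (z j - z' j) ^+ 2 = 0.
  apply/eqP; rewrite eq_le sumr_ge0 ?andbT; last by move=> j _; exact: sqr_ge0.
  by rewrite -(pmulr_rle0 _ e0); lra.
apply/funext => j; apply/eqP; rewrite -subr_eq0 -sqrf_eq0.
rewrite (psumr_eq0P (fun j _ => sqr_ge0 (z j - z' j)) sum0)//.
Qed.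

(* In case (A5b) a drop of the predicted aggregate payment [t * Z] would force
   every [t * z j] to rise. *)
Lemma mismatch_nondecreasing caseA a b c K t t' e z z' :
  monotone_marginal c K -> (forall j, K j `<=` [set u | 0 <= u]) ->
  0 < b -> 0 < e -> 0 <= t' -> t' < t ->
  regularized_equilibrium caseA a b c K t e z ->
  regularized_equilibrium caseA a b c K t' e z' ->
  if caseA then phat caseA a b (\sum_l z' l) t' <= phat caseA a b (\sum_l z l) t
  else phat caseA a b (\sum_l z l) t <= phat caseA a b (\sum_l z' l) t'.
Proof.
move=> mono K0 b0 e0 t'0 tt' zE z'E.
have key j : (z j - z' j) * ((derive1 (c j) (z j) - derive1 (c j) (z' j)) -
    (phat caseA a b (\sum_l z l) t - phat caseA a b (\sum_l z' l) t') +
    ((if caseA then b else t) * z j - (if caseA then b else t') * z' j) +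
    e * (z j - z' j)) <= 0.
  have [Kz /(_ (z' j)) H] := zE j; have [Kz' /(_ (z j)) H'] := z'E j.
  have {}H := H Kz'; have {}H' := H' Kz.
  by move: H H'; rewrite /grad_f => H H'; lra.
have monoj j : 0 <= (z j - z' j) * (derive1 (c j) (z j) - derive1 (c j) (z' j)).
  by apply: mono; [case: (zE j)|case: (z'E j)].
(* By contradiction: an output moving the wrong way would give every term of the bracket in [key]
   the sign of [z j - z' j], some of them strictly. *)
case: caseA zE z'E key => zE z'E; rewrite leNgt => key; apply/negP => lt;
  move: lt key; rewrite /phat.
- set Z := \sum_l z l; set Z' := \sum_l z' l => lt key.
  have : Z' < Z by rewrite -(ltr_pM2l b0); lra.
  suff : Z <= Z' by move=> ?; lra.
  apply: ler_sum => j _; rewrite leNgt; apply/negP => lt'.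
  have u0 : 0 < z j - z' j by rewrite subr_gt0.
  have := key j; have := monoj j; rewrite pmulr_rge0// pmulr_rle0// => H1 H2.
  have := mulr_gt0 b0 u0; have := mulr_gt0 e0 u0; lra.
- set Z := \sum_l z l; set Z' := \sum_l z' l => lt key.
  suff : t' * Z' <= t * Z by lra.
  rewrite /Z /Z' !mulr_sumr; apply: ler_sum => j _.
  have z0 : 0 <= z j by apply: (K0 j); case: (zE j).
  have [le|lt'] := leP (z' j) (z j).
    apply: le_trans (ler_wpM2l t'0 le) _; apply: ler_wpM2r => //; exact: ltW.
  rewrite leNgt; apply/negP => lt''; have u0 : z j - z' j < 0 by rewrite subr_lt0.
  have := key j; have := monoj j; rewrite nmulr_rge0// nmulr_rle0// => H1 H2.
  have : e * (z j - z' j) < 0 by rewrite pmulr_rlt0.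
  lra.
Qed.

(** [z] and [xs] are tested against each other. The parameter error and the regularisation perturb
    the gradient by at most [C], over displacements of at most [M] in each coordinate; the price
    slope supplies the modulus [b]. *)
Lemma regularized_equilibrium_dist caseA a b c K t e z xs (M : R) :
  monotone_marginal c K -> (forall j u, K j u -> 0 <= u <= M) ->
  0 < b -> 0 < e -> solves_VI a b c K xs ->
  regularized_equilibrium caseA a b c K t e z ->
  forall j, b * (z j - xs j) ^+ 2 <=
    N%:R * M * (`|t - theta_star caseA a b| * (1 + N.+1%:R * M) + e * M).
Proof.
move=> mono KM b0 e0 [Kxs xsVI] zE j0.
have Kz j : K j (z j) by case: (zE j).
have M0 : 0 <= M by have /andP[/le_trans] := KM _ _ (Kz j0); apply.
set dt := `|t - _|; pose C := dt * (1 + N.+1%:R * M) + e * M.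
have dt0 : 0 <= dt by exact: normr_ge0.
have C0 : 0 <= C by rewrite addr_ge0 ?mulr_ge0 ?addr_ge0 ?mulr_ge0 ?ler0n// ltW.
pose D := \sum_(l < N) z l - \sum_(l < N) xs l.
(* Deviating in a single coordinate splits the summed inequality by firm. *)
have xs1 j y : K j y -> 0 <= (y - xs j) * F_VI a b c xs j.
  move=> Ky; have := xsVI (fun l => if l == j then y else xs l).
  rewrite (bigD1 j)//= eqxx big1 ?addr0; last first.
    by move=> l /negbTE ->; rewrite subrr mul0r.
  by apply => l; case: eqP => [->|_].
(* The difference is [- (t - a)] in case (A5a), and [t - b] times a sum of [N.+1] outputs in case
   (A5b); the factor covers both. *)
have gradE j : `|grad_f caseA a b c j z t - F_VI a b c z j| <= dt * (1 + N.+1%:R * M).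
  have Z0 : 0 <= \sum_(l < N) z l by apply: sumr_ge0 => l _; case/andP: (KM _ _ (Kz l)).
  have ZN : \sum_(l < N) z l <= N%:R * M.
    rewrite -[X in X%:R * _]card_ord -sum1_card natr_sum mulr_suml.
    by apply: ler_sum => l _; rewrite mul1r; case/andP: (KM _ _ (Kz l)).
  have /andP[z0 zM] := KM _ _ (Kz j).
  have NM : 0 <= N.+1%:R * M by rewrite mulr_ge0.
  rewrite /dt /grad_f /F_VI /phat /theta_star; case: (caseA).
    rewrite (_ : _ - _ = - (t - a)); last ring.
    by rewrite normrN ler_peMr ?lerDl.
  rewrite (_ : _ - _ = (t - b) * (\sum_(l < N) z l + z j)); last ring.
  rewrite normrM ler_wpM2l// ger0_norm ?addr_ge0// -natr1; lra.
have key j : b * D * (z j - xs j) + b * (z j - xs j) ^+ 2 <= M * C.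
  have [_ /(_ (xs j)) H] := zE j; have H' := xs1 j (z j) (Kz j).
  have {}H := H (Kxs j); have Mj := mono j _ _ (Kz j) (Kxs j).
  have /andP[z0 zM] := KM _ _ (Kz j); have /andP[x0 xM] := KM _ _ (Kxs j).
  set E := grad_f caseA a b c j z t - F_VI a b c z j.
  have EC : `|E + e * z j| <= C.
    apply: le_trans (ler_normD _ _) _; apply: lerD; first exact: gradE.
    by rewrite normrM !ger0_norm// ?(ltW e0)// ler_wpM2l// ltW.
  have dM : `|z j - xs j| <= M by rewrite ler_norml; apply/andP; split; lra.
  have : `|(z j - xs j) * (E + e * z j)| <= M * C by rewrite normrM ler_pM.
  rewrite ler_norml => /andP[lo _].
  move: H; rewrite (_ : grad_f _ _ _ _ _ _ _ = F_VI a b c z j + E); last by rewrite /E; ring.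
  move=> H; move: H H'; rewrite /F_VI (_ : \sum_(l < N) z l = \sum_(l < N) xs l + D); last by rewrite /D; ring.
  nra.
have sumle : b * D ^+ 2 + b * \sum_(j < N) (z j - xs j) ^+ 2 <= N%:R * M * C.
  rewrite expr2 mulrA {2}/D -sumrB !mulr_sumr -big_split/=.
  rewrite -mulrA -[X in X%:R * _]card_ord -sum1_card natr_sum mulr_suml.
  by apply: ler_sum => j _; rewrite mul1r; exact: key.
apply: le_trans sumle; rewrite (bigD1 j0)//= mulrDr.
rewrite addrCA lerDl; apply: addr_ge0; apply: mulr_ge0 (ltW b0) _ => //.
  exact: sqr_ge0.
by apply: sumr_ge0 => j _; exact: sqr_ge0.
Qed.

End Game.

(** * A strong law of large numbers for bounded variables *)

Lemma bounded_integrable {R : realType} {d : measure_display}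
    {T : measurableType d} (P : probability T R) (X : T -> R) (M : R) :
  measurable_fun setT X -> (forall w, `|X w| <= M) ->
  P.-integrable setT (EFin \o X).
Proof.
move=> mX XM; apply: measurable_bounded_integrable => //.
  by apply: le_lt_trans (ltry 1); exact: probability_le1.
exists M; split; first exact: num_real.
by move=> y My w _ /=; apply: le_trans (XM w) _; exact: ltW.
Qed.

(** Independence on rectangles makes the joint law the product of the marginal laws, and Fubini
    splits the integral. *)
Lemma integral_mul_independent {R : realType} {d : measure_display}
    {T : measurableType d} (P : probability T R) (X Y : {RV P >-> R}) (M : R) :
  (forall w, `|X w| <= M) -> (forall w, `|Y w| <= M) ->
  (forall A B : set R, measurable A -> measurable B ->
     P (X @^-1` A `&` Y @^-1` B) = (P (X @^-1` A) * P (Y @^-1` B))%E) ->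
  (\int[P]_w (X w * Y w)%:E = (\int[P]_w (X w)%:E) * (\int[P]_w (Y w)%:E))%E.
Proof.
move=> XM YM XY.
have mX : measurable_fun setT X by [].
have mY : measurable_fun setT Y by [].
pose Z w := (X w, Y w).
have mZ : measurable_fun setT Z by exact: measurable_fun_pair.
pose Z' : {RV P >-> (R * R)%type} := mfun_Sub (mem_set mZ).
pose f (z : R * R) : \bar R := (z.1 * z.2)%:E.
have mf : measurable_fun setT f.
  by apply/measurable_EFinP; apply: measurable_funM => //; exact: measurable_snd.
have iX := bounded_integrable P X M mX XM.
have iY := bounded_integrable P Y M mY YM.
have iZ : P.-integrable setT (f \o Z').
  apply: (bounded_integrable P (fun w => X w * Y w) (M * M)).
    exact: measurable_funM.
  by move=> w; rewrite normrM ler_pM.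
pose mu := distribution P X; pose nu := distribution P Y.
have prodE A : measurable A -> (mu \x nu)%E A = distribution P Z' A.
  by apply: product_measure_unique => A1 A2 mA1 mA2; exact: XY.
have imunu : (mu \x nu)%E.-integrable setT f.
  have : (distribution P Z').-integrable setT f by exact: integrable_pushforward.
  case/integrableP => _ fin; apply/integrableP; split => //.
  apply: le_lt_trans fin; rewrite le_eqVlt; apply/orP; left; apply/eqP.
  by apply: eq_measure_integral => A mA _; exact: prodE.
transitivity (\int[mu \x nu]_z f z)%E.
  rewrite (eq_measure_integral (distribution P Z')); last by move=> A mA _; exact: prodE.
  by rewrite integral_distribution.
rewrite -integral12_prod_meas1// /fubini_F/= /f/=.
have imu : mu.-integrable setT EFin by apply: integrable_pushforward.
have inu : nu.-integrable setT EFin by apply: integrable_pushforward.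
have YE : (\int[nu]_y y%:E = \int[P]_w (Y w)%:E)%E by rewrite integral_distribution.
have XE : (\int[mu]_y y%:E = \int[P]_w (X w)%:E)%E by rewrite integral_distribution.
under eq_integral do (under eq_integral do rewrite EFinM; rewrite integralZl//).
have /fineK <- : (\int[P]_w (Y w)%:E)%E \is a fin_num by exact: integrable_fin_num.
by rewrite YE -XE -integralZr//; apply: eq_integral => y _; rewrite fineK//; exact: integrable_fin_num.
Qed.

Lemma sqr_cvg0 {R : realType} (u : nat -> R) :
  u n ^+ 2 @[n --> \oo] --> 0 -> u n @[n --> \oo] --> 0.
Proof.
move=> u2; apply/cvgr0Pnorm_lt => e e0.
have e2 : 0 < e ^+ 2 by rewrite exprn_gt0.
move/cvgr0Pnorm_lt : u2 => /(_ _ e2); apply: filterS => n.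
by rewrite normrX ltr_pXn2r// nnegrE// ltW.
Qed.

(** Telescoping: [1 / m ^ 2 <= 2 / m - 2 / (m + 1)] for [m >= 1]. *)
Lemma series_inv_sqr_le {R : realType} (n : nat) :
  \sum_(i < n) (i.+1%:R ^+ 2)^-1 <= 2 - 2 / n.+1%:R :> R.
Proof.
elim: n => [|n IH]; first by rewrite big_ord0; lra.
rewrite big_ord_recr/=; apply: le_trans (lerD IH (lexx _)) _.
have n1 : 0 < n.+1%:R :> R by rewrite ltr0n.
have n2 : n.+2%:R = n.+1%:R + 1 :> R by rewrite -natr1.
rewrite n2; set m : R := n.+1%:R in n1 n2 *.
have m1 : 1 <= m by rewrite /m ler1n.
rewrite -subr_ge0.
have -> : 2 - 2 / (m + 1) - (2 - 2 / m + (m ^+ 2)^-1) = (m - 1) / (m ^+ 2 * (m + 1)).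
  by field; rewrite !gt_eqF// addr_gt0.
by rewrite divr_ge0 ?subr_ge0// mulr_ge0 ?sqr_ge0// addr_ge0// ltW.
Qed.

(* The squares are spaced by [2 n + 1], so the values in between drift from
   [s (n ^ 2)] by at most [2 n M]. *)
Lemma cvg_average_of_squares {R : realType} (s : nat -> R) (M : R) :
  (forall n, `|s n.+1 - s n| <= M) ->
  s (n ^ 2)%N / (n ^ 2)%:R @[n --> \oo] --> 0 ->
  s n / n%:R @[n --> \oo] --> 0.
Proof.
move=> sM s2.
have M0 : 0 <= M by apply: le_trans (sM 0%N).
have drift m k : `|s (m + k)%N - s m| <= k%:R * M.
  elim: k => [|k IH]; first by rewrite addn0 subrr normr0 mul0r.
  rewrite addnS -natr1 mulrDl mul1r.
  rewrite (_ : _ - _ = (s (m + k).+1 - s (m + k)%N) + (s (m + k)%N - s m)); last ring.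
  by apply: le_trans (ler_normD _ _) _; rewrite addrC lerD.
apply/cvgr0Pnorm_le => e e0.
have e2 : 0 < e / 2 by rewrite divr_gt0.
(* From [N1] on the averages at squares are at most [e / 2]; from [N2] on the drift [2 * n * M] is
   at most [e / 2 * n ^ 2]. *)
move/cvgr0Pnorm_le : s2 => /(_ _ e2)[N1 _ HN1].
pose N2 := (Num.truncn (2 * M / (e / 2))).+1.
have HN2 : 2 * M / (e / 2) < N2%:R by exact: truncnS_gt.
exists ((N1 + N2) ^ 2)%N => // m /= lm.
(* The largest such [n] is the integer square root of [m]. *)
pose p := [pred n | (n ^ 2 <= m)%N].
have p0 : exists n, p n by exists 0%N.
have pm n : p n -> (n <= m)%N.
  by rewrite /p/= => /(leq_trans _); apply; rewrite expnS expn1; case: n => // n; rewrite leq_pmulr.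
case: (ex_maxnP p0 pm) => n pn nmax; rewrite /p/= in pn.
have ln : (N1 + N2 <= n)%N by apply: nmax.
have n0 : (0 < n)%N by apply: leq_trans ln; rewrite addnS.
have lt : (m < n.+1 ^ 2)%N by rewrite ltnNge; apply/negP => /nmax; rewrite ltnn.
have m0 : (0 < m)%N by apply: leq_trans pn; rewrite expn_gt0 n0.
have mR : 0 < m%:R :> R by rewrite ltr0n.
have nR : 0 < n%:R :> R by rewrite ltr0n.
rewrite normrM normfV (ger0_norm (ltW mR)) ler_pdivrMr//.
have nm : n%:R ^+ 2 <= m%:R :> R by rewrite -natrX ler_nat.
have sn2 : `|s (n ^ 2)%N| <= e / 2 * n%:R ^+ 2.
  have := HN1 n (leq_trans (leq_addr _ _) ln); rewrite /= normrM normfV natrX.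
  by rewrite (ger0_norm (sqr_ge0 _)) ler_pdivrMr// exprn_gt0.
have := drift (n ^ 2)%N (m - n ^ 2)%N; rewrite subnKC// => dm.
have kn : (m - n ^ 2)%:R <= 2 * n%:R :> R.
  rewrite -natrM ler_nat leq_subLR -ltnS; apply: leq_trans lt _.
  by rewrite -[n.+1]addn1 sqrnD exp1n muln1 addnAC addn1.
have big : 2 * n%:R * M <= e / 2 * n%:R ^+ 2.
  have : 2 * M / (e / 2) <= n%:R.
    by apply: le_trans (ltW HN2) _; rewrite ler_nat; apply: leq_trans ln; rewrite leq_addl.
  by rewrite ler_pdivrMr// => H; rewrite expr2; nra.
rewrite (_ : s m = (s m - s (n ^ 2)%N) + s (n ^ 2)%N); last ring.
apply: le_trans (ler_normD _ _) _.
have : (m - n ^ 2)%:R * M <= 2 * n%:R * M by rewrite ler_wpM2r.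
have : e / 2 * n%:R ^+ 2 <= e / 2 * m%:R by rewrite ler_pM2l.
lra.
Qed.

(** By monotone convergence the series has finite integral, hence is finite almost everywhere, and
    its terms vanish in the limit. *)
Lemma nnsum_integral_cvg0 {R : realType} {d : measure_display}
    {T : measurableType d} (P : probability T R) (f : nat -> T -> R) (B : R) :
  (forall n, measurable_fun setT (f n)) -> (forall n w, 0 <= f n w) ->
  (forall n, (\sum_(i < n) \int[P]_w (f i w)%:E <= B%:E)%E) ->
  {ae P, forall w, f n w @[n --> \oo] --> 0}.
Proof.
move=> mf f0 fB.
pose g w := (\sum_(n <oo) (f n w)%:E)%E.
have mEf n : measurable_fun setT (EFin \o f n) by exact/measurable_EFinP.
have ig : P.-integrable setT g.
  apply/integrableP; split.
    by apply: ge0_emeasurable_sum => [k w _ _|k _]; [rewrite lee_fin|exact: mEf].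
  have -> : (\int[P]_w `|g w| = \int[P]_w g w)%E.
    apply: eq_integral => w _; rewrite gee0_abs//.
    by apply: nneseries_ge0 => n _ _; rewrite lee_fin.
  rewrite integral_nneseries//; last by move=> n w _; rewrite lee_fin.
  apply: le_lt_trans (ltry B); apply: lime_le.
    by apply: is_cvg_nneseries => n _ _; apply: integral_ge0 => w _; rewrite lee_fin.
  by apply: nearW => n; rewrite /= big_mkord.
have := integrable_ae measurableT ig.
apply: filterS => w /(_ I) gfin.
apply: cvg_series_cvg_0; apply: nondecreasing_is_cvgn.
  by apply/nondecreasing_seqP => n; rewrite -subr_ge0 seriesSB.
exists (fine (g w)) => _ [n _ <-].
rewrite -lee_fin fineK// /series/= -sumEFin.
by apply: nneseries_lim_ge => m _ _; rewrite lee_fin.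
Qed.

Section BoundedOrthogonal.
Context {R : realType} {d : measure_display} {T : measurableType d}.
Context (P : probability T R) (X : nat -> T -> R) (M : R).
Hypothesis mX : forall k, measurable_fun setT (X k).
Hypothesis XM : forall k w, `|X k w| <= M.
Hypothesis orthX : forall i j, i != j -> (\int[P]_w (X i w * X j w)%:E = 0)%E.

Let S n w := \sum_(l < n) X l w.

Let mS n : measurable_fun setT (S n).
Proof. exact: measurable_sum. Qed.

Let SM n w : `|S n w| <= n%:R * M.
Proof.
apply: le_trans (ler_norm_sum _ _ _) _.
rewrite -[X in X%:R * _]card_ord -sum1_card natr_sum mulr_suml.
by apply: ler_sum => l _; rewrite mul1r.
Qed.

Let integralD2 (f g : T -> R) (A B : R) :
  measurable_fun setT f -> measurable_fun setT g ->
  (forall w, `|f w| <= A) -> (forall w, `|g w| <= B) ->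
  (\int[P]_w (f w + g w)%:E = \int[P]_w (f w)%:E + \int[P]_w (g w)%:E)%E.
Proof.
move=> mf mg fA gB; rewrite -integralD_EFin//.
  exact: (bounded_integrable P f A).
exact: (bounded_integrable P g B).
Qed.

Let orthS n m : (n <= m)%N -> (\int[P]_w (S n w * X m w)%:E = 0)%E.
Proof.
elim: n => [|n IH] nm.
  by rewrite integral0_eq// => w _; rewrite /S big_ord0 mul0r.
under eq_integral do rewrite /S big_ord_recr/= mulrDl.
rewrite (integralD2 _ _ (n%:R * M * M) (M * M)).
- by rewrite IH ?(ltnW nm)// orthX ?adde0// neq_ltn nm.
- by apply: measurable_funM; [exact: mS|exact: mX].
- by apply: measurable_funM; exact: mX.
- by move=> w; rewrite normrM ler_pM// SM.
- by move=> w; rewrite normrM ler_pM.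
Qed.

(** Cross terms integrate to 0, so each new variable adds at most [M ^+ 2]. *)
Let second_moment n : (\int[P]_w (S n w ^+ 2)%:E <= (n%:R * M ^+ 2)%:E)%E.
Proof.
elim: n => [|n IH].
  by rewrite mul0r integral0_eq// => w _; rewrite /S big_ord0 expr0n.
have XX w : `|X n w ^+ 2| <= M ^+ 2 by rewrite normrX lerXn2r// ?nnegrE// (le_trans _ (XM n w)).
have SX w : `|S n w * X n w| <= n%:R * M * M by rewrite normrM ler_pM// SM.
have SS w : `|S n w ^+ 2| <= (n%:R * M) ^+ 2.
  by rewrite normrX lerXn2r// ?nnegrE// ?SM// (le_trans _ (SM n w)).
have mSX : measurable_fun setT (fun w => S n w * X n w)
  by apply: measurable_funM; [exact: mS|exact: mX].
have mXX : measurable_fun setT (fun w => X n w ^+ 2)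
  by apply: measurable_funX; exact: mX.
have mSS : measurable_fun setT (fun w => S n w ^+ 2)
  by apply: measurable_funX; exact: mS.
have -> : (\int[P]_w (S n.+1 w ^+ 2)%:E =
    \int[P]_w ((S n w ^+ 2 + X n w ^+ 2) + (S n w * X n w + S n w * X n w))%:E)%E.
  by apply: eq_integral => w _; rewrite /S big_ord_recr/=; congr EFin; ring.
have SX2 w : `|S n w * X n w + S n w * X n w| <= n%:R * M * M + n%:R * M * M.
  by apply: le_trans (ler_normD _ _) _; exact: lerD.
have SXX w : `|S n w ^+ 2 + X n w ^+ 2| <= (n%:R * M) ^+ 2 + M ^+ 2.
  by apply: le_trans (ler_normD _ _) _; exact: lerD.
rewrite (integralD2 _ _ _ _ _ _ SXX SX2); [|exact: measurable_funD..].
rewrite (integralD2 _ _ _ _ mSS mXX SS XX) (integralD2 _ _ _ _ mSX mSX SX SX).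
rewrite orthS// !adde0 -natr1 mulrDl mul1r EFinD; apply: leeD => //.
have -> : ((M ^+ 2)%:E = \int[P]_w (M ^+ 2)%:E)%E.
  by rewrite integral_cst//= probability_setT mule1.
apply: ge0_le_integral => //.
- by move=> w _; rewrite lee_fin sqr_ge0.
- exact/measurable_EFinP.
- by move=> w _; rewrite lee_fin -[leLHS]ger0_norm ?sqr_ge0.
Qed.

Lemma bounded_orthogonal_slln :
  {ae P, forall w, (\sum_(l < n) X l w) / n%:R @[n --> \oo] --> 0}.
Proof.
(* The second moment bound gives [f n] mean at most [M ^+ 2 / n.+1 ^ 2], which is summable; starting
   at [n.+1] keeps the divisor nonzero. *)
pose f n w := (S (n.+1 ^ 2)%N w / (n.+1 ^ 2)%:R) ^+ 2.
have mf n : measurable_fun setT (f n).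
  by apply: measurable_funX; apply: measurable_funM => //; exact: mS.
have : {ae P, forall w, f n w @[n --> \oo] --> 0}.
  apply: (@nnsum_integral_cvg0 _ _ _ _ _ (M ^+ 2 * 2)) => // [n w|n].
    exact: sqr_ge0.
  apply: (@le_trans _ _ (\sum_(i < n) (M ^+ 2 * (i.+1%:R ^+ 2)^-1)%:E)%E).
    apply: lee_sum => i _.
    pose q : R := (i.+1 ^ 2)%:R.
    have q0 : 0 < q by rewrite ltr0n expn_gt0.
    have -> : (\int[P]_w (f i w)%:E = (q ^- 2)%:E * \int[P]_w (S (i.+1 ^ 2)%N w ^+ 2)%:E)%E.
      rewrite -ge0_integralZl//.
      - by apply: eq_integral => w _; rewrite -EFinM /f expr_div_n mulrC.
      - by apply/measurable_EFinP; apply: measurable_funX; exact: mS.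
      - by move=> w _; rewrite lee_fin sqr_ge0.
      - by rewrite lee_fin invr_ge0 sqr_ge0.
    apply: le_trans (lee_wpmul2l _ (second_moment _)) _.
      by rewrite lee_fin invr_ge0 sqr_ge0.
    rewrite -EFinM lee_fin -natrX -/q le_eqVlt; apply/orP; left; apply/eqP.
    by field; rewrite gt_eqF.
  rewrite sumEFin lee_fin -mulr_sumr ler_wpM2l ?sqr_ge0//.
  by apply: le_trans (series_inv_sqr_le n) _; rewrite gerBl divr_ge0.
apply: filterS => w fw; apply: (@cvg_average_of_squares _ (S ^~ w) M).
  by move=> n; rewrite /S big_ord_recr/= addrAC subrr add0r.
by rewrite -cvg_shiftS/=; exact: sqr_cvg0.
Qed.

End BoundedOrthogonal.

Lemma bounded_iid_slln {R : realType} {d : measure_display}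
    {T : measurableType d} (P : probability T R) (X : nat -> T -> R) (M : R) :
  (forall k, measurable_fun setT (X k)) -> (forall k w, `|X k w| <= M) ->
  mutually_independent P X -> (forall k, (\int[P]_w (X k w)%:E = 0)%E) ->
  {ae P, forall w, (\sum_(l < n) X l w) / n%:R @[n --> \oo] --> 0}.
Proof.
move=> mX XM ind X0; apply: (@bounded_orthogonal_slln _ _ _ P X M) => // i j ij.
pose Xi : {RV P >-> R} := mfun_Sub (mem_set (mX i)).
pose Xj : {RV P >-> R} := mfun_Sub (mem_set (mX j)).
rewrite (integral_mul_independent P Xi Xj M)//=; first by rewrite X0 mul0e.
move=> A B mA mB.
(* Mutual independence is specialised to the pair [i], [j]. *)
have := ind [:: i; j] _ (fun k => if k == i then A else B).
rewrite big_cons big_seq1 eqxx (negbTE (_ : j != i)) 1?eq_sym//.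
rewrite /= inE ij => /(_ isT) <-; last by move=> k; case: ifP.
congr (P _); apply/seteqP; split => w /=.
  move=> [Aw Bw] k /=; rewrite !inE => /orP[/eqP->|/eqP->]; first by rewrite eqxx.
  by rewrite (negbTE (_ : j != i)) 1?eq_sym.
move=> H; split.
  by have := H i; rewrite /= eqxx; apply; rewrite !inE eqxx.
have := H j; rewrite /= (negbTE (_ : j != i)) 1?eq_sym//; apply.
by rewrite !inE eqxx orbT.
Qed.

(** * Consensus of the firms *)

(* By uniqueness of the coupled fixed point all firms compute the same
   estimates, so each one reconstructs the true aggregate. *)
Lemma bvtheta_average {R : realType} {T : Type} {N : nat} (caseA : bool)
    (a b : R) (c : 'I_N -> R -> R) (K : 'I_N -> set R) (delta Delta : R)
    (xi : nat -> T -> R) (eps : nat -> R) (gth : R)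
    (x : 'I_N -> nat -> T -> 'I_N -> R) (th : 'I_N -> nat -> T -> R) (w : T) :
  monotone_marginal c K -> (forall j, K j `<=` [set z | 0 <= z]) ->
  (exists j, K j `<=` [set z | 0 < z]) -> 0 < b -> 0 < delta ->
  (forall k, (0 < k)%N -> 0 <= theta_star caseA a b + xi k w) ->
  (forall k, 0 < eps k) -> 0 < gth ->
  (forall i k, regularized_equilibrium caseA a b c K
     (thhat caseA a b x th xi i k.+1 w) (eps k) (x i k.+1 w)) ->
  (forall i k, is_proj (Theta_set delta Delta)
     (th i k.+1 w - gth * (ptilde caseA a b x th xi i k w + eps k * th i k.+1 w))
     (th i k.+1 w)) ->
  forall k i, bvtheta caseA a b x xi i k w =
    (\sum_(l < k) (theta_star caseA a b + xi l.+1 w)) / k%:R.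
Proof.
move=> mono K0 [j0 Kj0] b0 delta0 obs0 eps0 gth0 xE thE.
set V := fun k => \sum_(l < k) (theta_star caseA a b + xi l.+1 w).
have V0 k : 0 <= V k by apply: sumr_ge0 => l _; exact: obs0.
have Tcvx : convex_setR (Theta_set delta Delta).
  move=> u v t /andP[u1 u2] /andP[v1 v2] /andP[t0 t1]; apply/andP; split; nra.
have Kx i k j : K j (x i k.+1 w j) by case: (xE i k j).
elim=> [|k IH] i; first by rewrite /V big_ord0 mul0r.
have k1 : 0 < k.+1%:R :> R by rewrite ltr0n.
(* In case (A5b) the estimate is the price slope, so both uniqueness and monotonicity of the
   mismatch rest on this sign. *)
have thhat0 i1 : 0 <= thhat caseA a b x th xi i1 k.+1 w.
  rewrite /= IH; have [[/andP[th0 _] _]] := thE i1 k.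
  apply: addr_ge0; last by apply: mulr_ge0; apply: divr_ge0 => //; exact: V0.
  by apply: divr_ge0 => //; exact: le_trans (ltW delta0) th0.
(* Equal running means carry a strict order of [th] over to [thhat]. The two parameter inequalities,
   each tested at the other firm's estimate, then contradict the monotone mismatch and
   [0 < eps k]. *)
have not_lt i1 i2 : ~~ (th i2 k.+1 w < th i1 k.+1 w).
  apply/negP => lt.
  have lt_hat : thhat caseA a b x th xi i2 k.+1 w < thhat caseA a b x th xi i1 k.+1 w.
    by rewrite /= !IH ltrD2r ltr_pM2r// invr_gt0.
  have := mismatch_nondecreasing _ _ _ _ _ _ _ _ _ _ mono K0 b0 (eps0 k) (thhat0 i2) lt_hat
    (xE i1 k) (xE i2 k).
  have [Th1 _] := thE i1 k; have [Th2 _] := thE i2 k.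
  have := is_proj_variational _ _ _ _ _ Tcvx gth0 (thE i1 k) Th2.
  have := is_proj_variational _ _ _ _ _ Tcvx gth0 (thE i2 k) Th1.
  have u0 : 0 < th i1 k.+1 w - th i2 k.+1 w by rewrite subr_gt0.
  have eu := mulr_gt0 (eps0 k) u0.
  rewrite /ptilde /Xest -(opprB (th i1 k.+1 w)) mulNr oppr_ge0 pmulr_rge0// pmulr_rle0//.
  by rewrite mulrBr in eu; case: (caseA) => H1 H2 H3; lra.
have same_th i1 i2 : th i1 k.+1 w = th i2 k.+1 w.
  by apply/eqP; rewrite eq_le !leNgt !not_lt.
have same_x i1 i2 : x i1 k.+1 w = x i2 k.+1 w.
  apply: (@regularized_equilibrium_unique _ _ caseA a b c K
    (thhat caseA a b x th xi i1 k.+1 w) (eps k)) => //.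
    by case: (caseA) thhat0 => //; rewrite ltW.
  by rewrite /= IH (same_th i1 i2) -(IH i2); exact: xE.
have XestE : Xest x i k.+1 w = Xact x k.+1 w.
  by apply: eq_bigr => j _; rewrite (same_x i j).
have Xpos : 0 < Xact x k.+1 w.
  rewrite -XestE /Xest (bigD1 j0)//= ltr_pwDl//; first exact/Kj0/Kx.
  by apply: sumr_ge0 => j _; exact/K0/Kx.
have vE : vtheta caseA a b x xi i k.+1 w = theta_star caseA a b + xi k.+1 w.
  rewrite /vtheta XestE /= /obs_price /theta_star; case: (caseA); first ring.
  by field; rewrite gt_eqF.
rewrite -/bvtheta /= IH vE /V big_ord_recr/=; congr (_ / _); congr (_ + _).
(* At [k = 0] the factor [k] cannot be cancelled, but the weight and the empty sum are both 0. *)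
case: k {IH k1 thhat0 not_lt same_th same_x XestE Xpos vE} => [|k].
  by rewrite mul0r big_ord0.
by rewrite mulrC mulfVK// pnatr_eq0.
Qed.

(** * Almost sure convergence of estimates and outputs *)

Lemma bounded_family {R : realType} {N : nat} (K : 'I_N -> set R) :
  (forall j, bounded_set (K j)) ->
  exists M : R, forall j u, K j u -> u <= M.
Proof.
move=> bK; have /choice[m Hm] : forall j, exists m : R, forall u, K j u -> u <= m.
  move=> j; have [m [_ Hm]] := bK j; exists (m + 1) => u Ku.
  by apply: le_trans (ler_norm u) _; apply: Hm Ku; rewrite ltrDl.
exists (\sum_j `|m j|) => j u Ku; rewrite (bigD1 j)//=.
apply: le_trans (Hm _ _ Ku) _; apply: le_trans (ler_norm _) _.
by rewrite lerDl sumr_ge0.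
Qed.
Theorem theorem3
  (R : realType) (d : measure_display) (T : measurableType d) (P : probability T R)
  (N : nat) (caseA : bool) (a b : R)
  (c : 'I_N -> R -> R) (K : 'I_N -> set R)
  (delta Delta : R)
  (xi : nat -> T -> R)
  (eps : nat -> R) (gx gth : R)
  (x : 'I_N -> nat -> T -> 'I_N -> R) (th : 'I_N -> nat -> T -> R) :
  (* true price parameters *)
  0 < a -> 0 < b ->
  (* (A5): noise xi^1, xi^2, ... i.i.d. real random variables with mean zero *)
  (forall k, measurable_fun setT (xi k)) ->
  mutually_independent P (fun k => xi k.+1) ->
  (forall k (B : set R), measurable B -> P (xi k.+1 @^-1` B) = P (xi 1 @^-1` B)) ->
  (forall k, (0 < k)%N -> (\int[P]_w (xi k w)%:E = 0)%E) ->
  (* (A7): costs convex, C^1, with Lipschitz derivative on K_j *)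
  (forall j, convex_on (K j) (c j)) ->
  (forall j z, K j z -> derivable (c j) z 1) ->
  (forall j, {within K j, continuous derive1 (c j)}) ->
  (forall j, exists L : R, forall z1 z2, K j z1 -> K j z2 ->
       `|derive1 (c j) z1 - derive1 (c j) z2| <= L * `|z1 - z2|) ->
  (* (A7)-(A8): K_j nonempty, closed, convex, bounded subsets of [0, oo) *)
  (forall j, K j !=set0) -> (forall j, closed (K j)) ->
  (forall j, convex_setR (K j)) -> (forall j, bounded_set (K j)) ->
  (forall j, K j `<=` [set z | 0 <= z]) ->
  (* some K_j requires strictly positive output *)
  (exists j, K j `<=` [set z | 0 < z]) ->
  (* (A8): Theta = [delta, Delta], 0 < delta < theta* + xi^k < Delta *)
  0 < delta ->
  (forall k w, (0 < k)%N ->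
     delta < theta_star caseA a b + xi k w < Delta) ->
  (* algorithm constants: eps^k > 0 decreasing to 0, gamma_x, gamma_theta > 0 *)
  (forall k, 0 < eps k) -> (forall k, eps k.+1 <= eps k) ->
  eps n @[n --> \oo] --> 0 ->
  0 < gx -> 0 < gth ->
  (* initial actual outputs are feasible *)
  (forall w j, K j (x j 0 w j)) ->
  (* Algorithm II: at each step k, (x_i^{k+1}, theta_i^{k+1}) solves the
     projection fixed-point equations *)
  (forall w i k j,
     is_proj (K j)
       (x i k.+1 w j - gx * (grad_f caseA a b c j (x i k.+1 w)
                               (thhat caseA a b x th xi i k.+1 w)
                             + eps k * x i k.+1 w j))
       (x i k.+1 w j)) ->
  (forall w i k,
     is_proj (Theta_set delta Delta)
       (th i k.+1 w - gth * (ptilde caseA a b x th xi i k w + eps k * th i k.+1 w))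
       (th i k.+1 w)) ->
  (* conclusions *)
  (forall i, {ae P, forall w,
     thhat caseA a b x th xi i k w @[k --> \oo] --> theta_star caseA a b}) /\
  (forall xs, solves_VI a b c K xs ->
   forall i, {ae P, forall w, forall j,
     x i k w j @[k --> \oo] --> xs j}).
Proof.
move=> a0 b0 mxi indep _ mean0 cvx der _ _ _ _ Kcvx bK K0 Kpos delta0 xiT
  eps0 _ epscvg gx0 gth0 _ xP thP.
have mono : monotone_marginal c K.
  by move=> j u v Ku Kv; apply: (@convex_on_derive1_mono _ (K j)) => //; exact: der.
have xE w i k : regularized_equilibrium caseA a b c K
    (thhat caseA a b x th xi i k.+1 w) (eps k) (x i k.+1 w).
  move=> j; split; first by case: (xP w i k j).
  by move=> y Ky; exact: is_proj_variational (xP w i k j) Ky.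
have obs0 w k : (0 < k)%N -> 0 <= theta_star caseA a b + xi k w.
  by move=> k0; have /andP[/ltW/(le_trans (ltW delta0))] := xiT k w k0.
have avg w := @bvtheta_average _ _ _ caseA a b c K delta Delta xi eps gth x th w
  mono K0 Kpos b0 delta0 (obs0 w) eps0 gth0 (xE w) (thP w).
have slln : {ae P, forall w, (\sum_(l < n) xi l.+1 w) / n%:R @[n --> \oo] --> 0}.
  (* The bound comes from [xi k.+1] lying between [delta] and [Delta], both shifted by the true
     parameter. *)
  apply: (@bounded_iid_slln _ _ _ P (fun k => xi k.+1)
    (`|delta| + `|Delta| + `|theta_star caseA a b|)) => // [k w|k]; last exact: mean0.
  have /andP[l u] := xiT k.+1 w isT.
  have := ler_norm delta; have := ler_norm Delta; have := ler_norm (theta_star caseA a b).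
  have := ler_norm (- delta); have := ler_norm (- Delta); have := ler_norm (- theta_star caseA a b).
  rewrite !normrN => *; rewrite ler_norml; apply/andP; split; lra.
have hat i : {ae P, forall w,
    thhat caseA a b x th xi i k w @[k --> \oo] --> theta_star caseA a b}.
  apply: filterS slln => w slln_w; set ts := theta_star caseA a b.
  rewrite -cvg_shiftS /=.
  (* Estimates confined to [[delta, Delta]] are killed by the weight [1 / k.+1], leaving the running
     mean. *)
  have thto0 : th i k.+1 w / k.+1%:R @[k --> \oo] --> 0.
    apply: (@squeeze_cvgr _ _ _ _ (fun=> 0) (fun k => Delta * harmonic k)).
    - apply: nearW => k; have [[/andP[l u] _]] := thP w i k; apply/andP; split.
        by rewrite divr_ge0// (le_trans (ltW delta0)).
      by rewrite ler_wpM2r// invr_ge0.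
    - exact: cvg_cst.
    - by rewrite -[X in _ --> X](mulr0 Delta); apply: cvgMl_tmp; exact: cvg_harmonic.
  have ratio : (k%:R / k.+1%:R : R) @[k --> \oo] --> (1 : R).
    have -> : (fun k => k%:R / k.+1%:R : R) = (fun k => 1 - harmonic k).
      by apply/funext => k; rewrite /harmonic/= -natr1; field; rewrite natr1.
    by rewrite -[X in _ --> X]subr0; apply: cvgB; [exact: cvg_cst|exact: cvg_harmonic].
  have bvto : bvtheta caseA a b x xi i k w @[k --> \oo] --> ts.
    (* Index 0 is skipped: the running mean is 0 there by convention, so [bvE] would fail. *)
    move: slln_w; rewrite -cvg_shiftS => slln_w.
    have bvE k : bvtheta caseA a b x xi i k.+1 w =
        ts + (\sum_(l < k.+1) xi l.+1 w) / k.+1%:R.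
      rewrite avg big_split/= sumr_const card_ord -[_ *+ k.+1]mulr_natr mulrDl mulfK//.
    rewrite -(cvg_shiftS (fun k => bvtheta caseA a b x xi i k w)) (funext bvE).
    have := cvgD (cvg_cst ts : ts @[_ --> \oo] --> ts) slln_w.
    by rewrite addr0 => H; exact: H.
  have := cvgD thto0 (cvgM ratio bvto).
  by rewrite add0r mul1r => H; exact: H.
split => // xs xsVI i.
(* The distance bound is pathwise, so outputs converge on the very event where the parameter
   estimate does. *)
apply: filterS (hat i) => w; rewrite -cvg_shiftS => hat_w j.
have [M KM] := bounded_family K bK.
have KM0 l u : K l u -> 0 <= u <= M by move=> Ku; apply/andP; split; [exact: K0 Ku|exact: KM Ku].
rewrite -cvg_shiftS; apply/subr_cvg0; apply: sqr_cvg0.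
pose B k := b^-1 * (N%:R * M * (`|thhat caseA a b x th xi i k.+1 w - theta_star caseA a b| *
  (1 + N.+1%:R * M) + eps k * M)).
apply: (@squeeze_cvgr _ _ _ _ (fun=> 0) B).
- apply: nearW => k; rewrite sqr_ge0/= /B ler_pdivlMl//.
  by apply: regularized_equilibrium_dist mono KM0 b0 _ xsVI _ j => //; exact: xE.
- exact: cvg_cst.
- rewrite -[X in _ --> X](mulr0 b^-1); apply: cvgMl_tmp.
  rewrite -[X in _ --> X](mulr0 (N%:R * M)); apply: cvgMl_tmp.
  rewrite -[X in _ --> X]addr0; apply: cvgD.
    rewrite -[X in _ --> X](mul0r (1 + N.+1%:R * M)); apply: cvgMr_tmp.
    by rewrite -[X in _ --> X](@normr0 _ R); apply: cvg_norm; apply/subr_cvg0.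
  by rewrite -[X in _ --> X](mul0r M); apply: cvgMr_tmp.
Qed.
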